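(* Let $\vec{\mathcal G}=([n],E)$ be an ergodic graph of a deterministic two-player mean-payoff game with $m=|E|$, and let the weights $(r_{ij})$ be independent absolutely continuous random variables with densities $f_{ij}$ such that $\mathbb E(r_{ij})\in[-1,1]$, $\mathrm{Var}(r_{ij})\le 1/\phi^2$ and $f_{ij}(y)\le\phi$ for all $(i,j),y$, for some $\phi>0$. Then for every $\varepsilon>0$, $$\mathbb P\Bigl(\Delta(r)\ge\frac{8m}{\varepsilon}\bigl(\phi+\sqrt{2m/\varepsilon}\bigr)\Bigr)\le\varepsilon .$$ In particular $\mathbb P\bigl(\Delta(r)\ge 8nm(\phi+\sqrt{2nm})\bigr)\le 1/n$.
   Context: Setting: directed graph $\vec{\mathcal G}=([n],E)$ without multiple edges, each vertex having an outgoing edge, $[n]=V_{\max}\uplus V_{\min}$, weights $r\in\mathbb R^E$. Ergodic equation in $(\lambda,u)$: $\lambda+u_i=\max_{(i,j)\in E}\{r_{ij}+u_j\}$ ($i\in V_{\max}$), $\lambda+u_i=\min_{(i,j)\in E}\{r_{ij}+u_j\}$ ($i\in V_{\min}$); $u$ is a bias if $(\lambda,u)$ solves it; ergodic graph: solvable for every $r$, in which case $\lambda$ (the value) is unique. A pair of policies (choices of outgoing edges at Max/Min vertices) is bias-induced if some bias makes each chosen edge attain the max/min. $\Xi$: pairs whose induced subgraph has exactly one directed cycle; $\mathcal P^{\sigma,\tau}$: set of $r$ for which $(\sigma,\tau)$ is the only bias-induced pair; $\mathcal U=\bigcup_\Xi\mathcal P^{\sigma,\tau}$ (its complement has measure zero,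 and for $r\in\mathcal U$ the bias is unique up to an additive constant). Condition number, for $r\in\mathcal U$: $\Delta(r)=\dfrac{\max\{|r_{ij}-\lambda|:(i,j)\in E\}}{\min\{|r_{ij}-\lambda+u_j-u_i|:(i,j)\in E,\ r_{ij}-\lambda+u_j-u_i\ne0\}}$, with $\lambda$ the value and $u$ a bias; by convention $\Delta(r)=1$ if the denominator's set is empty (only one pair of policies). *)

(* Defs.v *)
From HB Require Import structures.
From mathcomp Require Import all_boot all_order all_algebra.
From mathcomp Require Import all_classical all_reals all_analysis.
Set Implicit Arguments. Unset Strict Implicit. Unset Printing Implicit Defensive.
Import Order.TTheory GRing.Theory Num.Theory.
Local Open Scope classical_set_scope.
Local Open Scope ring_scope.

(** * Deterministic two-player mean-payoff games on a directed graph ([n], E).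
    Vertices are ['I_n]; the edge set is the boolean relation [E] (so there are
    no multiple edges); [isMax i] says i ∈ V_max (otherwise i ∈ V_min).
    Weights are [r : 'I_n -> 'I_n -> R]; only the values on edges matter. *)

Section Game.
Variables (R : realType) (n : nat) (E : rel 'I_n) (isMax : pred 'I_n).

Definition has_out_edges := forall i : 'I_n, exists j, E i j.

Definition nedges : nat := #|[set ij : 'I_n * 'I_n | E ij.1 ij.2]|.

(** (lam,u) solves the ergodic equation: at a Max vertex lam + u_i is the
    maximum of r_ij + u_j over the out-edges, at a Min vertex the minimum
    (max/min over a nonempty finite set written out). *)
Definition ergodic_eq (r : 'I_n -> 'I_n -> R) (lam : R) (u : 'I_n -> R) :=
  forall i : 'I_n,
    (exists2 j, E i j & lam + u i = r i j + u j) /\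
    (forall j, E i j ->
       if isMax i then r i j + u j <= lam + u i else lam + u i <= r i j + u j).

Definition ergodic_graph :=
  forall r : 'I_n -> 'I_n -> R, exists lam u, ergodic_eq r lam u.

(** A pair of policies (sigma, tau) is encoded as one map [p] choosing an
    outgoing edge (i, p i) at every vertex: p restricted to V_max is sigma,
    p restricted to V_min is tau. *)
Definition policy_pair (p : 'I_n -> 'I_n) := forall i, E i (p i).

Definition bias_induced (r : 'I_n -> 'I_n -> R) (p : 'I_n -> 'I_n) :=
  policy_pair p /\
  exists lam u, ergodic_eq r lam u /\
    forall i, lam + u i = r i (p i) + u (p i).

(** directed cycles of the subgraph induced by p (edges (i, p i)):
    nonempty duplicate-free sequences [c] with consecutive (cyclically)
    vertices joined by an edge; a cycle is determined up to rotation. *)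
Definition dcycle (p : 'I_n -> 'I_n) (c : seq 'I_n) :=
  [&& c != [::], uniq c & cycle (frel p) c].

Definition in_Xi (p : 'I_n -> 'I_n) :=
  policy_pair p /\
  exists2 c, dcycle p c & forall c', dcycle p c' -> exists k, c' = rot k c.

Definition in_Ppol (p : 'I_n -> 'I_n) (r : 'I_n -> 'I_n -> R) :=
  bias_induced r p /\
  forall q, bias_induced r q -> forall i, q i = p i.

Definition in_U (r : 'I_n -> 'I_n -> R) :=
  exists2 p, in_Xi p & in_Ppol p r.

Definition reduced_cost (r : 'I_n -> 'I_n -> R) (lam : R) (u : 'I_n -> R)
  (i j : 'I_n) : R := r i j - lam + u j - u i.

Definition Delta_num (r : 'I_n -> 'I_n -> R) (lam : R) : R :=
  \big[Num.max/0]_(ij : 'I_n * 'I_n | E ij.1 ij.2) `|r ij.1 ij.2 - lam|.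

Definition Delta_dens (r : 'I_n -> 'I_n -> R) (lam : R) (u : 'I_n -> R)
  : seq R :=
  [seq `|reduced_cost r lam u ij.1 ij.2| |
     ij <- enum [pred ij : 'I_n * 'I_n | E ij.1 ij.2 &&
                                        (reduced_cost r lam u ij.1 ij.2 != 0)]].

Definition Delta (r : 'I_n -> 'I_n -> R) (lam : R) (u : 'I_n -> R) : R :=
  if Delta_dens r lam u is d :: ds
  then Delta_num r lam / \big[Num.min/d]_(x <- d :: ds) x
  else 1.

(** The event "Delta(r) >= t" (for r in U, where Delta is well defined since
    the value is unique and the bias is unique up to an additive constant). *)
Definition Delta_ge (r : 'I_n -> 'I_n -> R) (t : R) :=
  in_U r /\ exists lam u, ergodic_eq r lam u /\ t <= Delta r lam u.

End Game.

Definition mutually_independent {d} {T : measurableType d} {R : realType}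
  (P : probability T R) (I : finType) (S : pred I) (Y : I -> T -> R) :=
  forall A : I -> set R, (forall i, S i -> measurable (A i)) ->
    P (\bigcap_(i in [set i | S i]) (Y i @^-1` A i))
    = (\prod_(i | S i) P (Y i @^-1` A i))%E.

Definition has_density {d} {T : measurableType d} {R : realType}
  (P : probability T R) (Y : T -> R) (f : R -> R) :=
  measurable_fun setT f /\ (forall y, 0 <= f y) /\
  forall A : set R, measurable A ->
    P (Y @^-1` A) = (\int[lebesgue_measure]_(x in A) (f x)%:E)%E.

(* Main.v *)
(** On [in_U] the policy pair [p] is strictly optimal for a bias [u].  If [u'] is
    another bias, the vertices minimizing (or maximizing) [u' - u] form a set
    stable under [p], which therefore contains the unique cycle of [p]; hence
    [u' - u] is constant, and the value and the bias are explicit affine functions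
    of the weights of the edges of [p].  Consequently, an edge [(i, j)] outside [p]
    has a threshold that depends only on the other weights, and its reduced cost
    is the distance of [r i j] to that threshold.  The threshold is independent of
    [r i j], whose density is at most [phi]; rounding the threshold to a multiple
    of [alpha], the reduced cost is nonzero and at most [alpha] with probability at
    most [2 * alpha * phi].  By Chebyshev's inequality all weights are at most
    [1 + s] in absolute value outside an event of probability
    [m / (phi * s) ^ 2], and then so is the value.  With
    [s = sqrt (2 * m / eps) / phi] and [alpha = 2 * (1 + s) / t], where [t] is the
    bound on the condition number, each of the two union bounds over the edges
    contributes [eps / 2]. *)

Require Import Defs.
From HB Require Import structures.
From mathcomp Require Import all_boot all_order all_algebra.
From mathcomp Require Import all_classical all_reals all_analysis.
From mathcomp Require Import measurable_realfun ring lra.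
Set Implicit Arguments. Unset Strict Implicit. Unset Printing Implicit Defensive.
Import Order.TTheory GRing.Theory Num.Theory.
Local Open Scope classical_set_scope.
Local Open Scope ring_scope.

(** * Policies with a single cycle: uniqueness of the bias and explicit formulas *)

Section StrictPolicies.
Context {R : realType} {n : nat}.
Implicit Types (F : rel 'I_n) (isMax : pred 'I_n) (p : 'I_n -> 'I_n).
Implicit Types (r : 'I_n -> 'I_n -> R) (lam : R) (u : 'I_n -> R).

(** Such a [c] lies on a cycle of [p], since it is reached from [p c], and every orbit enters that
    cycle. *)
Definition rooted p (c : 'I_n) := forall i, fconnect p i c.

(** The orbit of any vertex is eventually periodic; the cycle it enters is a rotation of the given
    one, hence contains the head [c0]. *)
Lemma in_Xi_rooted F p : in_Xi F p -> exists c, rooted p c.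
Proof.
case=> _ [[|c0 c'] // dc uniqc]; exists c0 => i.
have /loopingP/(_ (order p i))/trajectP[m mo iterm] := looping_order p i.
set y := iter m p i in iterm.
have cyc : fcycle p (orbit p y).
  (* It takes [order p i - m] steps to return from [y] to [y]; this positive count is expected as a
     successor. *)
  apply/(orbitPcycle 0 3); exists (order p i - m).-1.
  rewrite prednK ?subn_gt0// /y -iterD subnK; last exact: ltnW.
  exact: iterm.
have /uniqc[k ok] : dcycle p (orbit p y).
  rewrite /dcycle orbit_uniq cyc !andbT -size_eq0 size_orbit -lt0n.
  exact: order_gt0.
apply: (@connect_trans _ _ y); first exact: fconnect_iter.
by rewrite fconnect_orbit ok mem_rot mem_head.
Qed.

Definition tight r p lam u := forall i, lam + u i = r i (p i) + u (p i).

Definition strict_sol F isMax r p lam u :=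
  tight r p lam u /\
  forall i j, F i j -> j != p i ->
    if isMax i then r i j + u j < lam + u i else lam + u i < r i j + u j.

Lemma strict_sol_ergodic F isMax r p lam u :
  policy_pair F p -> strict_sol F isMax r p lam u -> ergodic_eq F isMax r lam u.
Proof.
move=> Fp [tp sp] i; split; first by exists (p i).
move=> j Fij; have [->|/(sp _ _ Fij)] := eqVneq j (p i).
  by case: ifP; rewrite tp.
by case: ifP => _ /ltW.
Qed.

(* The set where [h] is minimal is stable under [p], so it contains the root. *)
Lemma drift_root p c (h : 'I_n -> R) (mu : R) : rooted p c ->
  (forall i, h (p i) <= h i + mu \/ exists j, h j < h i + mu) ->
  0 <= mu /\ (mu <= 0 -> forall i, h c <= h i).
Proof.
move=> pc hstep; case: (@arg_minP _ _ _ c xpredT h isT) => i0 _ hmin.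
have mu0 : 0 <= mu.
  have [hp|[j hj]] := hstep i0.
    by have := hmin (p i0) isT; lra.
  by have := hmin j isT; lra.
split=> // mule0 i; have {mule0}mu0 : mu = 0 by lra.
have closed k : h (iter k p i0) = h i0.
  elim: k => //= k IH; apply/le_anti; rewrite hmin// andbT.
  have [|[j]] := hstep (iter k p i0); first by rewrite IH mu0 addr0.
  by rewrite IH mu0 addr0 => /(le_lt_trans (hmin j isT)); rewrite ltxx.
have /iter_findex <- := pc i0.
by rewrite closed hmin.
Qed.

(** Apply [drift_root] to [u' - u] with drift [lam' - lam], then to the opposite difference with the
    opposite drift. At the vertices of one player the edge of [p] gives the first alternative; at
    those of the other, an edge attaining the extremum for [u'] is the edge of [p] or, by
    strictness, gives the second. *)
Lemma strict_sol_unique F isMax r p c lam u lam' u' : rooted p c ->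
  policy_pair F p -> strict_sol F isMax r p lam u ->
  ergodic_eq F isMax r lam' u' ->
  lam' = lam /\ forall i, u' i - u i = u' c - u c.
Proof.
move=> pc Fp [tp sp] erg.
have [mu0 hmin] : 0 <= lam' - lam /\
    (lam' - lam <= 0 -> forall i, u' c - u c <= u' i - u i).
  apply: (@drift_root p c (fun i => u' i - u i)) => // i /=; have [[j Fij ej] hi] := erg i.
  have := tp i; case iM: (isMax i) hi => hi ti.
    by left; have := hi _ (Fp i); lra.
  have [jp|jp] := eqVneq j (p i); first by left; rewrite -jp in ti *; lra.
  by right; exists j; have := sp _ _ Fij jp; rewrite iM; lra.
have [mu0' hmax] : 0 <= lam - lam' /\
    (lam - lam' <= 0 -> forall i, u c - u' c <= u i - u' i).
  apply: (@drift_root p c (fun i => u i - u' i)) => // i /=.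
  have [[j Fij ej] hi] := erg i.
  have := tp i; case iM: (isMax i) hi => hi ti; last first.
    by left; have := hi _ (Fp i); lra.
  have [jp|jp] := eqVneq j (p i); first by left; rewrite -jp in ti *; lra.
  by right; exists j; have := sp _ _ Fij jp; rewrite iM; lra.
split=> [|i]; first lra.
by have := hmin ltac:(lra) i; have := hmax ltac:(lra) i; lra.
Qed.

Lemma strict_sol_tight F isMax r p c lam u lam' u' q : rooted p c ->
  policy_pair F p -> strict_sol F isMax r p lam u ->
  policy_pair F q -> ergodic_eq F isMax r lam' u' -> tight r q lam' u' ->
  q =1 p.
Proof.
move=> pc Fp su Fq erg tq i; apply/eqP; apply: contraT => qp.
have [ll uu] := strict_sol_unique pc Fp su erg.
have [_ /(_ _ _ (Fq i) qp)] := su.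
have := tq i; rewrite ll; have := uu i; have := uu (q i).
by case: ifP => _; lra.
Qed.

Lemma strict_sol_in_Ppol F isMax r p c lam u : rooted p c ->
  policy_pair F p -> strict_sol F isMax r p lam u -> in_Ppol F isMax p r.
Proof.
move=> pc Fp su; have erg := strict_sol_ergodic Fp su; split.
  by split=> //; exists lam, u; split=> //; case: su.
move=> q [Fq [lam' [u' [erg' tq]]]].
exact: (strict_sol_tight pc Fp su Fq erg' tq).
Qed.

(** If an edge outside [p] attained the extremum at [i], redirecting [p] along it at [i] alone would
    give a second bias-induced pair. *)
Lemma in_Ppol_strict_sol F isMax r p lam u :
  in_Ppol F isMax p r -> ergodic_eq F isMax r lam u ->
  strict_sol F isMax r p lam u.
Proof.
move=> [[Fp _] uniqp] erg.
have biq q : policy_pair F q -> tight r q lam u -> q =1 p.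
  by move=> Fq tq; apply: uniqp; split=> //; exists lam, u.
have /boolp.choice[q qP] : forall i, exists j,
    F i j /\ lam + u i = r i j + u j.
  by move=> i; have [[j]] := erg i; exists j.
have tp : tight r p lam u.
  have qp : q =1 p by apply: biq => i; have [] := qP i.
  by move=> i; rewrite -qp; have [] := qP i.
split=> // i j Fij jp.
have neq : r i j + u j != lam + u i.
  apply: contra_neq jp => eij.
  rewrite -(biq (fun a => if a == i then j else p a)) ?eqxx//.
    by move=> a; case: eqP => // ->.
  by move=> a; case: eqP => // ->.
have [_ /(_ _ Fij)] := erg i.
by case: ifP => _ le; rewrite lt_neqAle le ?neq// eq_sym neq.
Qed.

Definition walk_weight r p k i :=
  \sum_(l < k) r (iter l p i) (p (iter l p i)).

(** The mean weight of the cycle through the root [c], whose length is [(findex p (p c) c).+1]. *)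
Definition pol_val r p c : R :=
  walk_weight r p (findex p (p c) c).+1 c / (findex p (p c) c).+1%:R.

(** The excess of the weights over the value, summed along the walk from [i] to [c]: the bias
    normalised to vanish at [c]. *)
Definition pol_bias r p c i : R :=
  walk_weight r p (findex p i c) i - (findex p i c)%:R * pol_val r p c.

(** The tight equations telescope along the walk. *)
Lemma tight_walk_weight r p lam u k i : tight r p lam u ->
  walk_weight r p k i = k%:R * lam + u i - u (iter k p i).
Proof.
move=> tp; rewrite /walk_weight; elim: k => [|k IH].
  by rewrite big_ord0 mul0r add0r subrr.
rewrite big_ord_recr/= IH.
have := tp (iter k p i); rewrite -natr1; lra.
Qed.

Lemma tight_pol_val r p c lam u : rooted p c -> tight r p lam u ->
  lam = pol_val r p c.
Proof.
move=> pc tp; rewrite /pol_val (tight_walk_weight _ _ tp) iterSr.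
by rewrite (iter_findex (pc _)) addrK mulrAC divff ?mul1r ?pnatr_eq0.
Qed.

Lemma tight_pol_bias r p c lam u i : rooted p c -> tight r p lam u ->
  pol_bias r p c i = u i - u c.
Proof.
move=> pc tp; rewrite /pol_bias (tight_walk_weight _ _ tp).
by rewrite -(tight_pol_val pc tp) (iter_findex (pc _)); ring.
Qed.

(** Trades an unspecified solution for explicit functions of the weights, whose measurability and
    dependence on single edges can be read off. *)
Lemma strict_sol_pol F isMax r p c lam u : rooted p c ->
  strict_sol F isMax r p lam u ->
  strict_sol F isMax r p (pol_val r p c) (pol_bias r p c).
Proof.
move=> pc su; have [tp sp] := su.
have b i := tight_pol_bias i pc tp; rewrite -(tight_pol_val pc tp).
split=> [i|i j Fij jp]; rewrite !b; first by have := tp i; lra.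
by have := sp _ _ Fij jp; case: ifP => _; lra.
Qed.

Lemma reduced_cost_pol r p c lam u i j : rooted p c -> tight r p lam u ->
  reduced_cost r (pol_val r p c) (pol_bias r p c) i j =
  reduced_cost r lam u i j.
Proof.
move=> pc tp; rewrite /reduced_cost !(tight_pol_bias _ pc tp).
by rewrite -(tight_pol_val pc tp); ring.
Qed.

Lemma pol_val_eq r r' p c : (forall i, r i (p i) = r' i (p i)) ->
  pol_val r p c = pol_val r' p c.
Proof. by move=> rr; congr (_ / _); apply: eq_bigr => l _; rewrite rr. Qed.

Lemma pol_bias_eq r r' p c i : (forall i, r i (p i) = r' i (p i)) ->
  pol_bias r p c i = pol_bias r' p c i.
Proof.
move=> rr; rewrite /pol_bias (pol_val_eq _ rr); congr (_ - _).
by apply: eq_bigr => l _; rewrite rr.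
Qed.

Lemma pol_val_le r p c (M : R) : (forall i, `|r i (p i)| <= M) ->
  `|pol_val r p c| <= M.
Proof.
move=> rM; rewrite /pol_val normrM normfV ler_pdivrMr ?normr_gt0 ?pnatr_eq0//.
apply: (le_trans (ler_norm_sum _ _ _)).
rewrite normr_nat mulr_natr -[X in M *+ X]card_ord -sumr_const.
by apply: ler_sum => l _.
Qed.

(* The first alternative is the convention [Delta r = 1] for an empty set of
   nonzero reduced costs. *)
Definition Delta_ge_at F r lam u t :=
  (t <= 1 /\ forall i j, F i j -> reduced_cost r lam u i j = 0) \/
  exists ab cd : 'I_n * 'I_n, [/\ F ab.1 ab.2, F cd.1 cd.2,
    reduced_cost r lam u ab.1 ab.2 != 0 &
    t * `|reduced_cost r lam u ab.1 ab.2| <= `|r cd.1 cd.2 - lam| ].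

(** The maximum and the minimum are attained, so a bound on their quotient is a bound for one pair
    of edges. This finite disjunction suits both measurability and the union bound. *)
Lemma Delta_ge_atP F r lam u t : 0 < t ->
  t <= Delta F r lam u <-> Delta_ge_at F r lam u t.
Proof.
move=> t0.
have mem x : x \in Delta_dens F r lam u <-> exists ab : 'I_n * 'I_n,
    [/\ F ab.1 ab.2, reduced_cost r lam u ab.1 ab.2 != 0 &
        x = `|reduced_cost r lam u ab.1 ab.2| ].
  split=> [/mapP[ab]|[ab [Fab rab ->]]].
    by rewrite mem_enum inE => /andP[? ?] ->; exists ab.
  by apply/mapP; exists ab; rewrite ?mem_enum ?inE ?Fab.
have pos x : x \in Delta_dens F r lam u -> 0 < x.
  by case/mem => ab [_ rab ->]; rewrite normr_gt0.
rewrite /Delta; case: (Delta_dens F r lam u) mem pos => [|d ds] mem pos.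
  split=> [t1|[[]//|[ab [_ [Fab _ rab _]]]]].
    left; split=> // i j Fij; apply/eqP; apply: contraT => rij.
    have : `|reduced_cost r lam u i j| \in [::] by apply/mem; exists (i, j).
    by [].
  have : `|reduced_cost r lam u ab.1 ab.2| \in [::] by apply/mem; exists ab.
  by [].
set mn := \big[Num.min/d]_(x <- _) x.
have mn_in : mn \in d :: ds.
  rewrite /mn.
  have: {subset d :: ds <= d :: ds} by [].
  (* Only the range of the minimum is generalised, to a list included in [d :: ds]; the default [d]
     and the target list stay fixed. *)
  elim: {-2 4}(d :: ds) => [|x s IH] sub; first by rewrite big_nil mem_head.
  rewrite big_cons; case: leP => _; first by apply: sub; rewrite mem_head.
  by apply: IH => y ys; apply: sub; rewrite inE ys orbT.
have mn_le x : x \in d :: ds -> mn <= x.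
  rewrite /mn; elim: (d :: ds) => // y s IH; rewrite inE big_cons ge_min.
  by case/orP => [/eqP->|/IH ->]; rewrite ?lexx ?orbT.
have num_ge (cd : 'I_n * 'I_n) : F cd.1 cd.2 ->
    `|r cd.1 cd.2 - lam| <= Delta_num F r lam.
  exact: (@le_bigmax_cond _ _ _ _ cd _ (fun e => `|r e.1 e.2 - lam|)).
(* Positivity guards against the default [0] of the maximum, which need not come from an edge. *)
have num_ex : 0 < Delta_num F r lam -> exists2 cd : 'I_n * 'I_n,
    F cd.1 cd.2 & Delta_num F r lam = `|r cd.1 cd.2 - lam|.
  rewrite /Delta_num.
  apply: (big_ind (fun y => 0 < y -> exists2 cd : 'I_n * 'I_n,
    F cd.1 cd.2 & y = `|r cd.1 cd.2 - lam|)); first by rewrite ltxx.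
    by move=> x y Hx Hy; rewrite maxEle; case: ifP.
  by move=> cd Fcd _; exists cd.
rewrite ler_pdivlMr ?pos//; split=> [tle|]; last first.
  case=> [[_ rc0]|[ab [cd [Fab Fcd rab tle]]]].
    have /mem[ab [Fab]] := mem_head d ds.
    by rewrite rc0// eqxx.
  apply: le_trans (num_ge _ Fcd); apply: le_trans tle.
  by rewrite ler_pM2l// mn_le//; apply/mem; exists ab.
right; have /mem[ab [Fab rab mnE]] := mn_in.
have [|cd Fcd numE] := num_ex.
  by apply: lt_le_trans tle; rewrite mulr_gt0// pos.
by exists ab, cd; rewrite -mnE -numE.
Qed.

Lemma Delta_ge_at_pol F r p c lam u t : rooted p c -> tight r p lam u ->
  Delta_ge_at F r lam u t ->
  Delta_ge_at F r (pol_val r p c) (pol_bias r p c) t.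
Proof.
move=> pc tp; case=> [[t1 rc0]|[ab [cd De]]].
  by left; split=> // i j Fij; rewrite (reduced_cost_pol _ _ pc tp) rc0.
right; exists ab, cd.
by rewrite (reduced_cost_pol _ _ pc tp) -(tight_pol_val pc tp).
Qed.

(** Presents the event as a finite union over policies and roots; [p] is a finite function so that
    it ranges over a finite type. *)
Lemma Delta_ge_pol F isMax r t : 0 < t ->
  Delta_ge F isMax r t <->
  exists (p : {ffun 'I_n -> 'I_n}) (c : 'I_n),
    [/\ in_Xi F p, rooted p c,
      strict_sol F isMax r p (pol_val r p c) (pol_bias r p c) &
      Delta_ge_at F r (pol_val r p c) (pol_bias r p c) t].
Proof.
move=> t0; split=> [[[p Xp Pp] [lam [u [erg tle]]]]|[p [c [Xp pc ss De]]]].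
  have /funext ffp : [ffun i => p i] =1 p by move=> i; rewrite ffunE.
  have [c pc] := in_Xi_rooted Xp; exists [ffun i => p i], c.
  rewrite ffp; have ss := in_Ppol_strict_sol Pp erg.
  have [tp _] := ss; split=> //; first exact: strict_sol_pol ss.
  by apply: Delta_ge_at_pol pc tp _; apply/Delta_ge_atP.
have Fp : policy_pair F p by case: Xp.
split; first by exists p => //; exact: strict_sol_in_Ppol ss.
exists (pol_val r p c), (pol_bias r p c); split.
  exact: strict_sol_ergodic ss.
exact/Delta_ge_atP.
Qed.

End StrictPolicies.

(** * Measurability of the events defined by policies *)

Section MeasurableEvents.
Context {d : measure_display} {T : measurableType d} {R : realType}.

Lemma measurable_set_forall (I : finType) (A : I -> T -> Prop) :
  (forall i, measurable [set w | A i w]) ->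
  measurable [set w | forall i, A i w].
Proof.
move=> mA; rewrite [X in measurable X](_ : _ = \bigcap_(i in setT) A i).
  by apply: fin_bigcap_measurable => // i _; exact: mA.
by apply/seteqP; split=> w /= Aw i //; exact: Aw.
Qed.

Lemma measurable_set_exists (I : finType) (A : I -> T -> Prop) :
  (forall i, measurable [set w | A i w]) ->
  measurable [set w | exists i, A i w].
Proof.
move=> mA; rewrite [X in measurable X](_ : _ = \bigcup_(i in setT) A i).
  by apply: fin_bigcup_measurable => // i _; exact: mA.
by apply/seteqP; split=> w [i]; [exists i | move=> _; exists i].
Qed.

Lemma measurable_set_cst (Q : Prop) : measurable [set _ : T | Q].
Proof.
have [q|q] := pselect Q.
  by rewrite [X in measurable X](_ : _ = setT)//; apply/seteqP; split.
by rewrite [X in measurable X](_ : _ = set0)//; apply/seteqP; split.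
Qed.

Lemma measurable_set_imply (Q : Prop) (A : T -> Prop) :
  measurable [set w | A w] -> measurable [set w | Q -> A w].
Proof.
move=> mA; have [q|q] := pselect Q.
  by rewrite [X in measurable X](_ : _ = A)//; apply/seteqP; split=> w /=; auto.
by rewrite [X in measurable X](_ : _ = setT)//; apply/seteqP; split=> // w _ /q.
Qed.

Lemma measurable_set_le (f g : T -> R) :
  measurable_fun setT f -> measurable_fun setT g ->
  measurable [set w | f w <= g w].
Proof.
move=> mf mg; rewrite -[X in measurable X]setTI.
exact: (measurable_fun_ler mf mg measurableT (Y := [set true])).
Qed.

Lemma measurable_set_lt (f g : T -> R) :
  measurable_fun setT f -> measurable_fun setT g ->
  measurable [set w | f w < g w].
Proof.
move=> mf mg; rewrite -[X in measurable X]setTI.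
exact: (measurable_fun_ltr mf mg measurableT (Y := [set true])).
Qed.

Lemma measurable_set_eq (f g : T -> R) :
  measurable_fun setT f -> measurable_fun setT g ->
  measurable [set w | f w = g w].
Proof.
move=> mf mg.
rewrite [X in measurable X](_ : _ = [set w | f w <= g w] `&` [set w | g w <= f w]).
  by apply: measurableI; exact: measurable_set_le.
apply/seteqP; split=> [w /= -> //|w /= [le1 le2]].
by apply/le_anti; rewrite le1.
Qed.

Lemma measurable_set_neq (f g : T -> R) :
  measurable_fun setT f -> measurable_fun setT g ->
  measurable [set w | f w != g w].
Proof.
move=> mf mg; rewrite [X in measurable X](_ : _ = ~` [set w | f w = g w]).
  by apply: measurableC; exact: measurable_set_eq.
by apply/seteqP; split=> w /= => [/eqP|?]; last exact/eqP.
Qed.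

Lemma measurable_set_and (A B : T -> Prop) :
  measurable [set w | A w] -> measurable [set w | B w] ->
  measurable [set w | A w /\ B w].
Proof. exact: measurableI. Qed.

Context {n : nat} (r : T -> 'I_n -> 'I_n -> R).
Hypothesis mr : forall i j, measurable_fun setT (fun w => r w i j).

Lemma measurable_walk_weight p k i :
  measurable_fun setT (fun w => walk_weight (r w) p k i).
Proof. by apply: measurable_sum => l; exact: mr. Qed.

Lemma measurable_pol_val p c : measurable_fun setT (fun w => pol_val (r w) p c).
Proof.
by apply: measurable_funM; [exact: measurable_walk_weight | exact: measurable_cst].
Qed.

Lemma measurable_pol_bias p c i :
  measurable_fun setT (fun w => pol_bias (r w) p c i).
Proof.
apply: measurable_funB; first exact: measurable_walk_weight.
by apply: measurable_funM; [exact: measurable_cst | exact: measurable_pol_val].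
Qed.

Lemma measurable_strict_sol F isMax p c :
  measurable [set w | strict_sol F isMax (r w) p
                        (pol_val (r w) p c) (pol_bias (r w) p c)].
Proof.
have ml i : measurable_fun setT
    (fun w => pol_val (r w) p c + pol_bias (r w) p c i).
  by apply: measurable_funD; [exact: measurable_pol_val | exact: measurable_pol_bias].
have mm i j : measurable_fun setT (fun w => r w i j + pol_bias (r w) p c j).
  by apply: measurable_funD; [exact: mr | exact: measurable_pol_bias].
apply: measurableI.
  by apply: measurable_set_forall => i; exact: measurable_set_eq.
apply: measurable_set_forall => i; apply: measurable_set_forall => j.
apply: measurable_set_imply; apply: measurable_set_imply.
by case: (isMax i); exact: measurable_set_lt.
Qed.

Lemma measurable_reduced_cost p c i j : measurable_fun setT
  (fun w => reduced_cost (r w) (pol_val (r w) p c) (pol_bias (r w) p c) i j).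
Proof.
apply: measurable_funB; last exact: measurable_pol_bias.
apply: measurable_funD; last exact: measurable_pol_bias.
by apply: measurable_funB; [exact: mr | exact: measurable_pol_val].
Qed.

Lemma measurable_Delta_ge F isMax t : 0 < t ->
  measurable [set w | Delta_ge F isMax (r w) t].
Proof.
move=> t0; under eq_set do rewrite (propext (Delta_ge_pol _ _ _ t0)).
apply: measurable_set_exists => p; apply: measurable_set_exists => c.
under eq_set do rewrite and4E.
apply: measurable_set_and; first exact: measurable_set_cst.
apply: measurable_set_and; first exact: measurable_set_cst.
apply: measurable_set_and; first exact: measurable_strict_sol.
apply: measurableU.
  apply: measurable_set_and; first exact: measurable_set_cst.
  apply: measurable_set_forall => i; apply: measurable_set_forall => j.
  apply: measurable_set_imply; apply: measurable_set_eq; last exact: measurable_cst.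
  exact: measurable_reduced_cost.
apply: measurable_set_exists => ab; apply: measurable_set_exists => cd.
under eq_set do rewrite and4E.
apply: measurable_set_and; first exact: measurable_set_cst.
apply: measurable_set_and; first exact: measurable_set_cst.
have mrc := measurable_reduced_cost p c ab.1 ab.2.
apply: measurable_set_and.
  by apply: measurable_set_neq => //; exact: measurable_cst.
apply: measurable_set_le.
  apply: measurable_funM; first exact: measurable_cst.
  exact: measurableT_comp.
apply: measurableT_comp => //.
by apply: measurable_funB; [exact: mr | exact: measurable_pol_val].
Qed.

End MeasurableEvents.

(** * Union bounds, independence and densities *)

Section Probability.
Context {d : measure_display} {T : measurableType d} {R : realType}.
Variable P : probability T R.

Lemma probability_exists_le (I : finType) (Q : pred I) (A : I -> T -> Prop)
    (x : R) :
  (forall i, Q i -> measurable [set w | A i w]) ->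
  (forall i, Q i -> (P [set w | A i w] <= x%:E)%E) ->
  (P [set w | exists2 i, Q i & A i w] <= (#|Q|%:R * x)%:E)%E.
Proof.
move=> mA PA.
have -> : [set w | exists2 i, Q i & A i w] = \big[setU/set0]_(i | Q i) A i.
  apply/seteqP; split=> w /= => [[i Qi Ai]|].
    by rewrite (bigD1 i)//=; left.
  apply: (big_ind (fun B : set T => B w -> exists2 i, Q i & A i w)) => //.
    by move=> B C HB HC [/HB|/HC].
  by move=> i Qi Ai; exists i.
suff [_ H] : measurable (\big[setU/set0]_(i | Q i) A i) /\
    (P (\big[setU/set0]_(i | Q i) A i) <= (\sum_(i | Q i) x)%:E)%E.
  by rewrite sumr_const -mulr_natl in H.
apply: (big_rec2 (fun (B : set T) y => measurable B /\ (P B <= y%:E)%E)).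
  by rewrite measure0.
move=> i B y Qi [mB PB]; split; first by apply: measurableU => //; exact: mA.
apply: (le_trans (measureU2 P (mA i Qi) mB)).
by rewrite EFinD leeD//; exact: PA.
Qed.

Lemma probability_bigcup (F : (set T)^nat) : (forall k, measurable (F k)) ->
  trivIset setT F -> P (\bigcup_k F k) = (\sum_(0 <= k <oo) P (F k))%E.
Proof.
by move=> mF tF; apply: measure_semi_bigcup => //; exact: bigcup_measurable.
Qed.

(* A pi-system generating the sigma-algebra of the coordinates other than [e]. *)
Definition cylinders (I : finType) (S : pred I) (Y : I -> T -> R) (e : I) :
    set (set T) :=
  [set B | exists A : I -> set R, [/\ forall i, measurable (A i), A e = setT &
      B = \bigcap_(i in [set i | S i]) (Y i @^-1` A i)]].

Lemma cylinders_coord (I : finType) (S : pred I) (Y : I -> T -> R) (e i : I)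
    (B : set R) : S i -> i != e -> measurable B ->
  cylinders S Y e (Y i @^-1` B).
Proof.
move=> Si ie mB; exists (fun j => if j == i then B else setT); split.
- by move=> j; case: ifP.
- by rewrite eq_sym (negbTE ie).
- apply/seteqP; split=> w /= => [Bw j _|/(_ i Si)]; last by rewrite eqxx.
  by case: eqP => // ->.
Qed.

(** Dynkin's argument: the sets [D] satisfying the product formula form a lambda-system that
    contains the pi-system of cylinders. *)
Lemma independent_coord (I : finType) (S : pred I) (Y : I -> T -> R) (e : I)
    (B : set R) (D : set T) :
  mutually_independent P S Y ->
  (forall i, S i -> measurable_fun setT (Y i)) -> S e -> measurable B ->
  <<s cylinders S Y e >> D ->
  measurable D /\ P (D `&` Y e @^-1` B) = (P D * P (Y e @^-1` B))%E.
Proof.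
move=> indep mY Se mB; set C := Y e @^-1` B.
have mpre i (A : set R) : S i -> measurable A -> measurable (Y i @^-1` A).
  by move=> Si mA; rewrite -[X in measurable X]setTI; exact: mY.
have mC : measurable C by exact: mpre.
have Pfin A : measurable A -> P A \is a fin_num by exact: fin_num_measure.
have compl (D' : set T) : measurable D' -> P (D' `&` C) = (P D' * P C)%E ->
    P (~` D' `&` C) = (P (~` D') * P C)%E.
  move=> mD PD; rewrite setIC -setDE.
  have -> : P (C `\` D') = (P C - P (C `&` D'))%E.
    by apply: measureD => //; rewrite ltey_eq Pfin.
  rewrite (setIC C D') PD probability_setC//.
  rewrite -(fineK (Pfin _ mD)) -(fineK (Pfin _ mC)).
  by rewrite -!(EFinM, EFinB); congr (_%:E); ring.
have union (F : (set T)^nat) : (forall k, measurable (F k)) ->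
    trivIset setT F -> (forall k, P (F k `&` C) = (P (F k) * P C)%E) ->
    P (\bigcup_k F k `&` C) = (P (\bigcup_k F k) * P C)%E.
  move=> mF tF HF; rewrite setI_bigcupl !probability_bigcup//; first last.
  - exact: trivIset_setIr.
  - by move=> k; exact: measurableI.
  rewrite muleC -(fineK (Pfin _ mC)) -nneseriesZl//.
  by apply: eq_eseriesr => k _; rewrite HF muleC fineK// Pfin.
apply: (@dynkin_induction _ (g_sigma_algebraType (cylinders S Y e))
  (cylinders S Y e)
  (fun D => d.-measurable D /\ P (D `&` C) = (P D * P C)%E)) => //.
- move=> _ _ [A [mA Ae ->]] [A' [mA' A'e ->]].
  exists (fun i => A i `&` A' i); split=> [i||].
  + exact: measurableI.
  + by rewrite Ae A'e setTI.
  + apply/seteqP; split=> w /= => [[Aw A'w] i Si|AA].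
      by split; [exact: Aw|exact: A'w].
    by split=> i Si; have [] := AA i Si.
- by split; [exact: measurableT | rewrite setTI probability_setT mul1e].
- move=> _ [A [mA Ae ->]]; split.
    apply: fin_bigcap_measurable => // i Si; exact: mpre.
  (* The cylinder leaves the coordinate [e] free, so putting [B] there turns the intersection into a
     product event, to which independence applies. *)
  pose A' i := if i == e then B else A i.
  have -> : (\bigcap_(i in [set i | S i]) (Y i @^-1` A i)) `&` C =
      \bigcap_(i in [set i | S i]) (Y i @^-1` A' i).
    apply/seteqP; split=> w /= => [[Aw Cw] i Si|A'w].
      by rewrite /A' /=; case: eqP => [->//|_]; exact: Aw.
    split=> [i Si /=|]; last by have := A'w e Se; rewrite /A' /= eqxx.
    have := A'w i Si; rewrite /A' /=; case: eqP => [->|//].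
    by rewrite Ae.
  rewrite !indep//; last by move=> i _; rewrite /A'; case: ifP.
  rewrite (bigD1 e)//= [in RHS](bigD1 e)//= /A' eqxx Ae preimage_setT.
  rewrite probability_setT mul1e muleC; congr (_ * _)%E.
  by apply: eq_bigr => i /andP[_ /negbTE ->].
- by move=> D' _ [mD PD]; split; [exact: measurableC | exact: compl].
- move=> F _ tF HF; have mF k : d.-measurable (F k) by have [] := HF k.
  split; first exact: bigcup_measurable.
  by apply: union => // k; have [] := HF k.
Qed.

(* [D k] fixes the cell of the random threshold, [C k] is the window of weights
   that this cell allows. *)
Lemma cellwise_probability_le (A : set T) (D C : nat -> set T) (K : R) :
  measurable A -> (forall k, measurable (D k)) -> (forall k, measurable (C k)) ->
  trivIset setT D ->
  (forall k, P (D k `&` C k) = (P (D k) * P (C k))%E) ->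
  (forall k, (P (C k) <= K%:E)%E) ->
  A `<=` \bigcup_k (D k `&` C k) -> (P A <= K%:E)%E.
Proof.
move=> mA mD mC tD indep PC sub.
have K0 : 0 <= K by rewrite -lee_fin (le_trans _ (PC 0%N)).
apply: le_trans (measure_sigma_subadditive P _ mA sub) _.
  by move=> k; exact: measurableI.
(* Independence bounds each term by [K * P (D k)]; by disjointness the [P (D k)] sum to at most
   1. *)
apply: (@le_trans _ _ (\sum_(0 <= k <oo) (K%:E * P (D k))))%E.
  apply: lee_nneseries => // k _.
  rewrite [leLHS](_ : _ = (P (C k) * P (D k))%E); last by rewrite muleC -indep.
  by rewrite lee_pmul.
rewrite nneseriesZl// -probability_bigcup//.
rewrite -[leRHS]mule1 lee_pmul ?lee_fin//.
by apply: probability_le1; exact: bigcup_measurable.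
Qed.

Lemma density_itv_le (Y : T -> R) (f : R -> R) (phi a b : R) :
  has_density P Y f -> (forall y, f y <= phi) -> a <= b ->
  (P (Y @^-1` `[a, b]) <= (phi * (b - a))%:E)%E.
Proof.
move=> [mf [f0 ->//]] fphi ab.
apply: (@le_trans _ _ (\int[lebesgue_measure]_(x in `[a, b]) (cst phi%:E x))%E).
  apply: ge0_le_integral => //= [x _||x _]; rewrite ?lee_fin//.
  by apply/measurable_EFinP; exact: measurable_funTS.
rewrite integral_cst//= lebesgue_measure_itv/= lte_fin.
(* The length formula gives 0 unless [a < b]; the degenerate case then needs only
   [0 <= f 0 <= phi]. *)
case: ifP => [_|/negbT]; first by rewrite -EFinB -EFinM.
by rewrite -leNgt => ba; rewrite mule0 lee_fin mulr_ge0 ?subr_ge0// (le_trans (f0 0)).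
Qed.

End Probability.

(** * Thresholds of edges and the probability of a small reduced cost *)

Section EdgeEvent.
Context {R : realType} {n : nat}.
Implicit Types (F E : rel 'I_n) (isMax : pred 'I_n) (p : 'I_n -> 'I_n).
Implicit Types (r : 'I_n -> 'I_n -> R).

(** The weight of [(i, j)] at which its reduced cost vanishes. *)
Definition threshold r p c i j : R :=
  pol_val r p c + pol_bias r p c i - pol_bias r p c j.

(** The additive constant of the bias cancels in the difference. This makes the cells of the
    threshold disjoint although each is a union over policies and roots. *)
Lemma threshold_unique F isMax r p c p' c' i j : rooted p c -> rooted p' c' ->
  policy_pair F p -> policy_pair F p' ->
  strict_sol F isMax r p (pol_val r p c) (pol_bias r p c) ->
  strict_sol F isMax r p' (pol_val r p' c') (pol_bias r p' c') ->
  threshold r p c i j = threshold r p' c' i j.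
Proof.
move=> pc pc' Fp Fp' ss /(strict_sol_ergodic Fp') erg.
have [vv bb] := strict_sol_unique pc Fp ss erg.
by rewrite /threshold vv; have := bb i; have := bb j; lra.
Qed.

Definition remove_edge E (e : 'I_n * 'I_n) : rel 'I_n :=
  fun a b => E a b && ((a, b) != e).

(** Zeroing the other entries makes everything computed from the masked game a function of the
    weights on [F] alone. *)
Definition mask F r a b : R := if F a b then r a b else 0.

Lemma policy_mask F r p a : policy_pair F p -> mask F r a (p a) = r a (p a).
Proof. by move=> Fp; rewrite /mask Fp. Qed.

Lemma threshold_mask F r p c i j : policy_pair F p ->
  threshold (mask F r) p c i j = threshold r p c i j.
Proof.
move=> Fp; have eqr a := policy_mask r a Fp.
by rewrite /threshold (pol_val_eq _ eqr) !(pol_bias_eq _ _ eqr).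
Qed.

Lemma strict_sol_mask F isMax r p c : policy_pair F p ->
  strict_sol F isMax r p (pol_val r p c) (pol_bias r p c) ->
  strict_sol F isMax (mask F r) p
    (pol_val (mask F r) p c) (pol_bias (mask F r) p c).
Proof.
move=> Fp; have eqr a := policy_mask r a Fp.
have -> : pol_bias (mask F r) p c = pol_bias r p c.
  by apply/funext => a; rewrite (pol_bias_eq _ _ eqr).
rewrite (pol_val_eq _ eqr) => -[tp sp]; split=> [a|a b Fab bp].
  by rewrite eqr.
by rewrite {1 2}/mask Fab; exact: sp.
Qed.

(* Here [r] is the game without the edge [(i, j)] and [x] the weight of that
   edge: [x] lies on the side of the threshold where the edge is not used. *)
Definition edge_event F isMax r (x : R) i j (alpha : R) :=
  exists (p : {ffun 'I_n -> 'I_n}) (c : 'I_n), [/\ in_Xi F p, rooted p c,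
    strict_sol F isMax r p (pol_val r p c) (pol_bias r p c) &
    if isMax i then threshold r p c i j - alpha <= x /\ x <= threshold r p c i j
    else threshold r p c i j <= x /\ x <= threshold r p c i j + alpha].

(** Edges of [p] have zero reduced cost, so the edge in the denominator lies outside [p], and [p]
    stays strictly optimal once that edge is removed. The numerator is at most [2 * M] because the
    value is an average of weights. *)
Lemma Delta_ge_edge_event E isMax r t (M : R) (p : {ffun 'I_n -> 'I_n}) c :
  in_Xi E p -> rooted p c -> 1 < t -> (forall i j, E i j -> `|r i j| <= M) ->
  strict_sol E isMax r p (pol_val r p c) (pol_bias r p c) ->
  Delta_ge_at E r (pol_val r p c) (pol_bias r p c) t ->
  exists2 e : 'I_n * 'I_n, E e.1 e.2 &
    edge_event (remove_edge E e) isMax (mask (remove_edge E e) r)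
      (r e.1 e.2) e.1 e.2 (2 * M / t).
Proof.
(* The assumption [1 < t] excludes the conventional value 1 of the condition number. *)
move=> [Ep Xp] pc t1 rM ss; case=> [[]|]; first by rewrite leNgt t1.
move=> [[i j] [cd [/= Eij Ecd rc0 tle]]]; have t0 : 0 < t by lra.
set F := remove_edge E (i, j); have [tp sp] := ss.
have pij : j != p i.
  apply: contraNneq rc0 => ->.
  by rewrite /reduced_cost; apply/eqP; have := tp i; lra.
have Fp : policy_pair F p.
  move=> a; rewrite /F /remove_edge Ep; apply: contraNneq pij.
  by case=> <- ->.
have ssF : strict_sol F isMax r p (pol_val r p c) (pol_bias r p c).
  by split=> // a b /andP[Eab _]; exact: sp.
exists (i, j) => //; exists p, c; split=> //; first exact: strict_sol_mask.
rewrite threshold_mask//= /threshold.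
have rc_le : `|reduced_cost r (pol_val r p c) (pol_bias r p c) i j| <= 2 * M / t.
  rewrite ler_pdivlMr// mulrC (le_trans tle)// (le_trans (ler_normB _ _))//.
  have := rM _ _ Ecd; have := pol_val_le c (fun a => rM _ _ (Ep a)); lra.
move: rc_le; rewrite ler_norml /reduced_cost => /andP[rc1 rc2].
by have := sp _ _ Eij pij; case: (isMax i) => st; split; lra.
Qed.

Context {d : measure_display} {T : measurableType d}.
Variables (P : probability T R) (X : 'I_n -> 'I_n -> T -> R).
Variables (E : rel 'I_n) (isMax : pred 'I_n).
Hypothesis mX : forall i j, measurable_fun setT (X i j).

Let masked (e : 'I_n * 'I_n) (w : T) :=
  mask (remove_edge E e) (fun a b => X a b w).

Lemma measurable_threshold {d'} {T' : measurableType d'}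
    (r : T' -> 'I_n -> 'I_n -> R) p c i j :
  (forall a b, measurable_fun setT (fun w => r w a b)) ->
  measurable_fun setT (fun w => threshold (r w) p c i j).
Proof.
move=> mr; apply: measurable_funB; last exact: measurable_pol_bias.
by apply: measurable_funD; [exact: measurable_pol_val | exact: measurable_pol_bias].
Qed.

Lemma measurable_edge_event e alpha :
  measurable [set w | edge_event (remove_edge E e) isMax (masked e w)
                        (X e.1 e.2 w) e.1 e.2 alpha].
Proof.
have mr a b : measurable_fun setT (fun w => masked e w a b).
  rewrite /masked /mask; case: (remove_edge E e a b); first exact: mX.
  exact: measurable_cst.
apply: measurable_set_exists => p; apply: measurable_set_exists => c.
under eq_set do rewrite and4E.
apply: measurable_set_and; first exact: measurable_set_cst.
apply: measurable_set_and; first exact: measurable_set_cst.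
apply: measurable_set_and; first exact: measurable_strict_sol.
have mt := measurable_threshold p c e.1 e.2 mr.
have mta (a : R) : measurable_fun setT
    (fun w => threshold (masked e w) p c e.1 e.2 + a).
  by apply: measurable_funD => //; exact: measurable_cst.
case: (isMax e.1); apply: measurable_set_and; apply: measurable_set_le => //.
Qed.

(** Round the threshold down to a multiple of [alpha]: each cell is an event of the other
    coordinates, and on it the weight must lie in a fixed window of length [2 * alpha]. *)
Lemma edge_event_probability_le i j (f : R -> R) (phi alpha : R) :
  E i j -> 0 < alpha ->
  mutually_independent P [pred ij : 'I_n * 'I_n | E ij.1 ij.2]
    (fun ij => X ij.1 ij.2) ->
  has_density P (X i j) f -> (forall y, f y <= phi) ->
  (P [set w | edge_event (remove_edge E (i, j)) isMax (masked (i, j) w)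
                (X i j w) i j alpha] <= (phi * (2 * alpha))%:E)%E.
Proof.
move=> Eij alpha0 indep densf fphi.
set S := [pred ij : 'I_n * 'I_n | E ij.1 ij.2] in indep.
set Y := (fun ij : 'I_n * 'I_n => X ij.1 ij.2) in indep.
set F := remove_edge E (i, j); set r := masked (i, j).
(* Measurability is with respect to the coordinates other than [(i, j)]: a kept entry is one of
   them, a masked entry is constant. *)
have mr a b : measurable_fun
    (setT : set (g_sigma_algebraType (cylinders S Y (i, j)))) (fun w => r w a b).
  rewrite /r /masked /mask; case Fab: (remove_edge E (i, j) a b).
    have /andP[Eab abij] := Fab.
    move=> _ B mB; rewrite setTI; apply: sub_sigma_algebra.
    exact: (@cylinders_coord _ _ _ _ S Y (i, j) (a, b)).
  exact: measurable_cst.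
(* Integers are enumerated by their codes; [pickle_inv] accepts one code per integer, as
   disjointness requires, and all other indices give an empty cell. *)
pose cell k (x : R) := if pickle_inv k is Some z
  then (z : int)%:~R <= x / alpha /\ x / alpha < (z + 1)%:~R else False.
pose D k := [set w | exists (p : {ffun 'I_n -> 'I_n}) (c : 'I_n),
  [/\ in_Xi F p, rooted p c,
    strict_sol F isMax (r w) p (pol_val (r w) p c) (pol_bias (r w) p c) &
    cell k (threshold (r w) p c i j)]].
have sD k : <<s cylinders S Y (i, j) >> (D k).
  suff : measurable (D k : set (g_sigma_algebraType (cylinders S Y (i, j)))) by [].
  apply: measurable_set_exists => p; apply: measurable_set_exists => c.
  under eq_set do rewrite and4E.
  apply: measurable_set_and; first exact: measurable_set_cst.
  apply: measurable_set_and; first exact: measurable_set_cst.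
  apply: measurable_set_and; first exact: measurable_strict_sol.
  have mt : measurable_fun
      (setT : set (g_sigma_algebraType (cylinders S Y (i, j))))
      (fun w => threshold (r w) p c i j / alpha).
    apply: measurable_funM; last exact: measurable_cst.
    exact: measurable_threshold.
  rewrite /cell; case: pickle_inv => [z|]; last exact: measurable_set_cst.
  by apply: measurable_set_and; [apply: measurable_set_le|apply: measurable_set_lt];
    rewrite //; exact: measurable_cst.
(* The threshold lies in [[z * alpha, (z + 1) * alpha)]; the weight is at most [alpha] below it at a
   Max vertex, at most [alpha] above it at a Min vertex. *)
pose J k : set R := if pickle_inv k is Some z then
    let lo := (z : int)%:~R * alpha - (if isMax i then alpha else 0) in
    `[lo, lo + 2 * alpha]%classic
  else set0.
have mJ k : measurable (J k) by rewrite /J; case: pickle_inv.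
have indD k := independent_coord indep (fun e _ => mX e.1 e.2) (Eij : S (i, j))
  (mJ k) (sD k).
apply: (@cellwise_probability_le _ _ _ P _ D (fun k => X i j @^-1` J k)) => //.
- exact: (measurable_edge_event (i, j)).
- by move=> k; have [] := indD k.
- by move=> k; rewrite -[X in measurable X]setTI; exact: mX.
(* At a common point both cells see the same threshold, so both integers are the floor of the same
   number. *)
- apply/trivIsetP => k l _ _ kl; apply/seteqP; split=> // w [].
  move=> [p [c [[Fp _] pc ss ck]]] [q [c' [[Fq _] qc ss' cl]]].
  move: cl; rewrite -(threshold_unique i j pc qc Fp Fq ss ss').
  have := pickle_invK (T := int) k; have := pickle_invK (T := int) l.
  move: ck; rewrite /cell.
  case: (pickle_inv k) => [z /= [z1 z2]|//]; case: (pickle_inv l) => [y /=|//].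
  move=> yl zk [y1 y2]; move: kl; rewrite -yl -zk.
  by rewrite -(@floor_def _ _ z (introT andP (conj z1 z2)))
    -(@floor_def _ _ y (introT andP (conj y1 y2))) eqxx.
- by move=> k; have [] := indD k.
- move=> k; rewrite /J; case: pickle_inv => [z /=|]; last first.
    rewrite preimage_set0 measure0 lee_fin !mulr_ge0// ?(ltW alpha0)//.
    by apply: le_trans (fphi 0); have [_ []] := densf.
  set lo := _ - _; have lo_le : lo <= lo + 2 * alpha by lra.
  apply: (le_trans (density_itv_le densf fphi lo_le)).
  by rewrite lee_fin; rewrite (_ : lo + 2 * alpha - lo = 2 * alpha)//; ring.
- move=> w [p [c [Xp pc ss tx]]].
  pose th := threshold (r w) p c i j.
  have [k kE] : exists k, pickle_inv k = Some (Num.floor (th / alpha)).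
    by exists (pickle (Num.floor (th / alpha))); exact: pickleK_inv.
  exists k => //; split=> /=.
    exists p, c; split=> //; rewrite /cell kE.
    by have /andP[] := floor_itv (th / alpha).
  rewrite /J kE /= in_itv/=.
  have /andP[] := floor_itv (th / alpha).
  rewrite ler_pdivlMr// ltr_pdivrMr// intrD mulr1z.
  move: tx; rewrite -/th; set z := (_%:~R : R).
  by case: (isMax i) => -[t1 t2] k1 k2; apply/andP; split; lra.
Qed.

End EdgeEvent.

(** * Choice of the parameters and union bound over the edges *)

Lemma nedges_gt0 (n : nat) (E : rel 'I_n) : (0 < n)%N -> has_out_edges E ->
  (0 < nedges E)%N.
Proof.
move=> n0 /(_ (Ordinal n0))[j Ej]; apply/card_gt0P.
by exists (Ordinal n0, j); rewrite inE.
Qed.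

Lemma Delta_ge_probability_le
  (R : realType) (n : nat) (E : rel 'I_n) (isMax : pred 'I_n)
  (d : measure_display) (T : measurableType d) (P : probability T R)
  (X : 'I_n -> 'I_n -> {RV P >-> R}) (f : 'I_n -> 'I_n -> R -> R) (phi eps : R) :
  (0 < n)%N ->
  has_out_edges E ->
  0 < phi ->
  mutually_independent P [pred ij : 'I_n * 'I_n | E ij.1 ij.2]
    (fun ij => (X ij.1 ij.2 : T -> R)) ->
  (forall i j, E i j -> has_density P (X i j) (f i j)) ->
  (forall i j, E i j ->
     (-1 <= 'E_P[X i j])%E /\ ('E_P[X i j] <= 1)%E) ->
  (forall i j, E i j -> ('V_P[X i j] <= (phi ^- 2)%:E)%E) ->
  (forall i j, E i j -> forall y, f i j y <= phi) ->
  0 < eps ->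
  (P [set w | Delta_ge E isMax (fun i j => X i j w)
       (8 * (nedges E)%:R / eps * (phi + Num.sqrt (2 * (nedges E)%:R / eps)))]
   <= eps%:E)%E.
Proof.
move=> n0 outE phi0 indep dens EX VX fphi eps0; set m := nedges E.
have mX i j : measurable_fun setT (X i j) by exact: measurable_funP.
have m1 : 1 <= m%:R :> R by rewrite ler1n; exact: nedges_gt0.
have m0 : 0 < m%:R :> R by lra.
set q := Num.sqrt _; have q2 : q ^+ 2 = 2 * m%:R / eps.
  by rewrite sqr_sqrtr// divr_ge0 ?mulr_ge0 ?(ltW eps0).
have q0 : 0 < q by rewrite sqrtr_gt0 divr_gt0 ?mulr_gt0//; lra.
set t := _ * (phi + q).
have t0 : 0 < t by rewrite mulr_gt0 ?divr_gt0 ?mulr_gt0 ?addr_gt0//; lra.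
have mDelta : measurable [set w | Delta_ge E isMax (fun i j => X i j w) t].
  exact: (@measurable_Delta_ge _ _ _ _ (fun w i j => X i j w)).
(* For [1 <= eps] the bound is trivial; otherwise [m / eps] exceeds 1, which forces [1 < t]. *)
have [eps1|eps1] := leP 1 eps.
  by apply: le_trans (probability_le1 P mDelta) _; rewrite lee_fin.
have me : 1 < m%:R / eps by rewrite ltr_pdivlMr//; lra.
have q1 : 1 < q.
  rewrite -(@ltr_pXn2r _ 2)// ?nnegrE ?ltW// q2 expr1n; move: me; rewrite -!mulrA; lra.
have t1 : 1 < t.
  rewrite /t -!mulrA; nra.
pose s := q / phi; have s0 : 0 < s by rewrite divr_gt0.
pose alpha := 2 * (1 + s) / t; have alpha0 : 0 < alpha.
  by rewrite divr_gt0// mulr_gt0//; lra.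
pose A (e : 'I_n * 'I_n) w :=
  edge_event (remove_edge E e) isMax
    (mask (remove_edge E e) (fun a b => X a b w)) (X e.1 e.2 w) e.1 e.2 alpha \/
  s <= `|X e.1 e.2 w - fine 'E_P[X e.1 e.2]|.
have mcheb (e : 'I_n * 'I_n) :
    measurable [set w | s <= `|X e.1 e.2 w - fine 'E_P[X e.1 e.2]|].
  apply: measurable_set_le; first exact: measurable_cst.
  apply: measurableT_comp => //.
  by apply: measurable_funB; [exact: mX | exact: measurable_cst].
have medge e := @measurable_edge_event _ _ _ _ (fun i j => X i j) E isMax mX e alpha.
have mA e : measurable [set w | A e w].
  exact: measurableU _ _ (medge e) (mcheb e).
have PA (e : 'I_n * 'I_n) : E e.1 e.2 -> (P [set w | A e w] <= (eps / m%:R)%:E)%E.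
  case: e => i j /= Eij.
  apply: (le_trans (measureU2 P (medge (i, j)) (mcheb (i, j)))).
  (* Both summands equal [eps / (2 * m)]: the first is [4 * (phi + q) / t], the second is
     [q ^- 2]. *)
  have -> : eps / m%:R = phi * (2 * alpha) + s ^- 2 * phi ^- 2.
    rewrite -invfM -exprMn divfK ?gt_eqF// q2 /alpha /s /t.
    by field; rewrite !gt_eqF// addr_gt0.
  rewrite EFinD leeD//.
    exact: edge_event_probability_le (dens i j Eij) (fphi i j Eij).
  apply: (le_trans (chebyshev (X i j) s0)).
  rewrite EFinM lee_pmul2l ?lte_fin ?invr_gt0 ?exprn_gt0//.
  exact: VX.
pose Q : pred ('I_n * 'I_n) := fun e => E e.1 e.2.
have -> : eps = #|Q|%:R * (eps / m%:R).
  have -> : #|Q| = m.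
    by apply: eq_card => e; apply/idP/idP => [/mem_set|/set_mem].
  by rewrite mulrC divfK ?gt_eqF.
apply: le_trans (@probability_exists_le _ _ _ P _ Q A _ (fun e _ => mA e) PA).
apply: le_measure; rewrite ?inE//.
  rewrite [X in measurable X](_ : _ = [set w | exists e : 'I_n * 'I_n,
      E e.1 e.2 /\ A e w]); last first.
    by apply/seteqP; split=> w [e]; [move=> ? ?; exists e | case=> ? ?; exists e].
  apply: measurable_set_exists => e; apply: measurable_set_and => //.
  exact: measurable_set_cst.
move=> w /= /(Delta_ge_pol _ _ _ t0)[p [c [Xp pc ss De]]].
have [[e [Ee far]]|near] := pselect (exists e : 'I_n * 'I_n,
    E e.1 e.2 /\ s <= `|X e.1 e.2 w - fine 'E_P[X e.1 e.2]|).
  by exists e => //; right.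
have XM i j : E i j -> `|X i j w| <= 1 + s.
  move=> Eij; have : ~ s <= `|X i j w - fine 'E_P[X i j]|.
    by move=> ?; apply: near; exists (i, j).
  move/negP; rewrite -ltNge => /ltW close.
  (* The bounds on the expectation rule out infinite values, so [fine] loses nothing. *)
  have [] := EX i j Eij; move: close; case: ('E_P[X i j])%E => [x||] //=.
  rewrite !lee_fin ler_norml => /andP[c1 c2] x1 x2.
  by rewrite ler_norml; apply/andP; split; lra.
have [e Ee ev] := Delta_ge_edge_event Xp pc t1 XM ss De.
by exists e => //; left.
Qed.

Unset Implicit Arguments.

Theorem mainTheorem15
  (R : realType) (n : nat) (E : rel 'I_n) (isMax : pred 'I_n)
  (d : measure_display) (T : measurableType d) (P : probability T R)
  (X : 'I_n -> 'I_n -> {RV P >-> R}) (f : 'I_n -> 'I_n -> R -> R) (phi : R) :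
  (0 < n)%N ->
  has_out_edges E ->
  ergodic_graph R E isMax ->
  0 < phi ->
  mutually_independent P [pred ij : 'I_n * 'I_n | E ij.1 ij.2]
    (fun ij => (X ij.1 ij.2 : T -> R)) ->
  (forall i j, E i j -> has_density P (X i j) (f i j)) ->
  (forall i j, E i j -> (X i j : T -> R) \in Lfun P 2%:E) ->
  (forall i j, E i j ->
     (-1 <= 'E_P[X i j])%E /\ ('E_P[X i j] <= 1)%E) ->
  (forall i j, E i j -> ('V_P[X i j] <= (phi ^- 2)%:E)%E) ->
  (forall i j, E i j -> forall y, f i j y <= phi) ->
  let m := nedges E in
  (forall eps : R, 0 < eps ->
     (P [set w | Delta_ge E isMax (fun i j => X i j w)
          (8 * m%:R / eps * (phi + Num.sqrt (2 * m%:R / eps)))]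
      <= eps%:E)%E)
  /\
  (P [set w | Delta_ge E isMax (fun i j => X i j w)
        (8 * n%:R * m%:R * (phi + Num.sqrt (2 * n%:R * m%:R)))]
   <= (n%:R^-1)%:E)%E.
Proof.
move=> n0 outE _ phi0 indep dens _ EX VX fphi /=; split=> [eps eps0|].
  exact: (Delta_ge_probability_le isMax n0 outE phi0 indep dens EX VX fphi).
have nR : 0 < n%:R :> R by rewrite ltr0n.
(* Taking [eps] to be [n%:R^-1] turns division by [eps] into multiplication by [n]. *)
have := Delta_ge_probability_le isMax n0 outE phi0 indep dens EX VX fphi
  (eps := n%:R^-1).
rewrite invr_gt0 nR !invrK => /(_ isT).
by rewrite (mulrAC 8) (mulrAC 2).
Qed.
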